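(* Let $(M,g)$ be a compact connected Riemannian manifold of dimension $n\ge 3$ whose metric is Chen–Nagano critical, i.e. there is a smooth 1-form $\theta$ on $M$ with $$E_g = B_g^*(\theta)-\frac{n-2}{2n}\,\bar s\, g .$$ Assume that $\theta$ is exact, $\theta=df$ with $f\in C^\infty(M)$, and that the scalar curvature $s_g$ is constant. Then $g$ is an Einstein metric. Moreover, the potential function $f$ is constant and the corresponding gradient Ricci almost soliton structure $$\mathrm{Ric}_g-\mathrm{Hess}_g(f)=\lambda g,\qquad \lambda=-\frac{n-2}{2n}\bar s+\tfrac12 s_g-\tfrac12\Delta_g f,$$ is trivial.
   Context: Manifolds are smooth and without boundary. $\mathrm{Ric}_g$ is the Ricci tensor, $s_g$ the scalar curvature, $E_g=\mathrm{Ric}_g-\tfrac12 s_g g$ the Einstein tensor, and $\bar s=\frac{1}{\mathrm{Vol}(M,g)}\int_M s_g\,dv_g$ the average scalar curvature. For a smooth 1-form $\theta$, $\delta\theta=-\nabla^i\theta_i$, $(\delta^*\theta)_{ij}=\tfrac12(\nabla_i\theta_j+\nabla_j\theta_i)$, and $B_g^*(\theta)=\delta^*\theta+\tfrac12(\delta\theta)\,g$. $\mathrm{Hess}_g(f)=\nabla df$ and $\Delta_g f=\mathrm{tr}_g(\mathrm{Hess}_g f)$. A metric is Einstein if $\mathrm{Ric}_g=\mu g$ for a constant $\mu$. A gradient Ricci almost soliton structure $(f,\lambda)$ is trivial if $f$ is constant (so $\mathrm{Hess}_g(f)=0$ and the equation reduces to the Einstein equation $\mathrm{Ric}_g=\lambda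 g$ with $\lambda$ constant). *)

(* Defs.v *)
From HB Require Import structures.
From mathcomp Require Export all_boot all_order all_algebra.
From mathcomp Require Export all_classical all_reals all_analysis.
Export Order.TTheory GRing.Theory Num.Theory numFieldNormedType.Exports.

Set Implicit Arguments.
Unset Strict Implicit.
Unset Printing Implicit Defensive.

Local Open Scope classical_set_scope.
Local Open Scope ring_scope.

Section calculus.
Variables (R : realType) (n : nat).
Implicit Types (U : set 'rV[R]_n) (u : 'rV[R]_n -> R).

Definition partial (i : 'I_n) u : 'rV[R]_n -> R :=
  fun x => 'D_(delta_mx 0 i) u x.

(* C^k on U; only used for open U, where continuity at the points of U and
   continuity of the restriction to U agree. *)
Fixpoint Ck (k : nat) U u : Prop :=
  (forall x, U x -> {for x, continuous u}) /\
  if k is k'.+1 then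
    forall i, (forall x, U x -> derivable u x (delta_mx 0 i)) /\
              Ck k' U (partial i u)
  else True.

Definition smooth_on U u := forall k, Ck k U u.

End calculus.

(* Integral over R^n against Lebesgue measure, as an iterated integral; it is
   applied below to nonnegative Borel functions only (Tonelli). *)
Fixpoint lebesgue_integral_rV (R : realType) (n : nat) :
    ('rV[R]_n -> \bar R) -> \bar R :=
  if n is n'.+1 then fun h =>
    (\int[@lebesgue_measure R]_t
       lebesgue_integral_rV (fun v : 'rV[R]_n' => h (row_mx (t%:M : 'rV_1) v)))%E
  else fun h => h 0.

Section manifold.
Variables (R : realType) (n : nat) (M : ptopologicalType).

Record chart := Chart {
  cdom : set M ;
  cimg : set 'rV[R]_n ;
  cmap : M -> 'rV[R]_n ;
  cinv : 'rV[R]_n -> M ;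
  cdom_open : open cdom ;
  cimg_open : open cimg ;
  cmap_cimg : forall p, cdom p -> cimg (cmap p) ;
  cinv_cdom : forall x, cimg x -> cdom (cinv x) ;
  cmapK : forall p, cdom p -> cinv (cmap p) = p ;
  cinvK : forall x, cimg x -> cmap (cinv x) = x ;
  cmap_continuous : forall p, cdom p -> {for p, continuous cmap} ;
  cinv_continuous : forall x, cimg x -> {for x, continuous cinv} }.

Definition transition (c d : chart) : 'rV[R]_n -> 'rV[R]_n := cmap d \o cinv c.

Definition overlap (c d : chart) : set 'rV[R]_n :=
  cimg c `&` cinv c @^-1` cdom d.

(* [chart_at] records a choice of a chart around each point; it only serves to
   read as functions on M the scalars that are computed in charts. *)
Record smooth_structure := SmoothStructure {
  atlas : set chart ;
  chart_at : M -> chart ;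
  chart_at_atlas : forall p, atlas (chart_at p) ;
  chart_at_cdom : forall p, cdom (chart_at p) p ;
  transition_smooth : forall c d, atlas c -> atlas d -> forall i : 'I_n,
    smooth_on (overlap c d) (fun x => transition c d x 0 i) ;
  manifold_hausdorff : hausdorff_space M ;
  manifold_second_countable : @second_countable M }.

(* P holds at every point, in the coordinates of every chart of the atlas. *)
Definition in_charts (X : smooth_structure)
    (P : chart -> 'rV[R]_n -> Prop) : Prop :=
  forall c, atlas X c -> forall x, cimg c x -> P c x.

(* Tensor fields are given by their components in the charts of the atlas,
   subject to the usual transformation law; with the library's row-vector
   convention, the (i, a) entry of 'J (transition c d) x is the i-th partial
   derivative of the a-th coordinate of the transition map. *)
Record riem_metric (X : smooth_structure) := RiemMetric {
  gmx :> chart -> 'rV[R]_n -> 'M[R]_n ;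
  gmx_smooth : forall c, atlas X c -> forall i j,
    smooth_on (cimg c) (fun x => gmx c x i j) ;
  gmx_sym : in_charts X (fun c x => (gmx c x)^T = gmx c x) ;
  gmx_pos : in_charts X (fun c x =>
    forall v : 'rV[R]_n, v != 0 -> 0 < (v *m gmx c x *m v^T) 0 0) ;
  gmx_transition : forall c d, atlas X c -> atlas X d ->
    forall x, overlap c d x ->
    gmx c x = 'J (transition c d) x *m gmx d (transition c d x)
              *m ('J (transition c d) x)^T }.

Record one_form (X : smooth_structure) := OneForm {
  form_comp :> chart -> 'rV[R]_n -> 'rV[R]_n ;
  form_smooth : forall c, atlas X c -> forall i,
    smooth_on (cimg c) (fun x => form_comp c x 0 i) ;
  form_transition : forall c d, atlas X c -> atlas X d ->
    forall x, overlap c d x ->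
    form_comp c x = form_comp d (transition c d x)
                    *m ('J (transition c d) x)^T }.

Definition smooth_function (X : smooth_structure) (f : M -> R) : Prop :=
  forall c, atlas X c -> smooth_on (cimg c) (f \o cinv c).

Definition differential (f : M -> R) (c : chart) (x : 'rV[R]_n) : 'rV[R]_n :=
  \row_i partial i (f \o cinv c) x.

End manifold.

Section riemannian.
Variables (R : realType) (n : nat) (M : ptopologicalType).
Variables (X : smooth_structure R n M) (g : riem_metric X).
Implicit Types (c : chart R n M) (x : 'rV[R]_n) (f : M -> R).
Implicit Types (theta : chart R n M -> 'rV[R]_n -> 'rV[R]_n).

Definition christoffel c (k i j : 'I_n) x : R :=
  2^-1 * \sum_l invmx (g c x) k l *
    (partial i (fun y => g c y j l) x + partial j (fun y => g c y i l) x
     - partial l (fun y => g c y i j) x).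

(* The k-th component of
   R(d_i, d_j) d_l = nabla_i nabla_j d_l - nabla_j nabla_i d_l. *)
Definition riemann c (k l i j : 'I_n) x : R :=
  partial i (christoffel c k j l) x - partial j (christoffel c k i l) x
  + \sum_m (christoffel c k i m x * christoffel c m j l x
            - christoffel c k j m x * christoffel c m i l x).

Definition ricci c x : 'M[R]_n := \matrix_(j, l) \sum_k riemann c k l k j x.

Definition trace_g c x (A : 'M[R]_n) : R :=
  \sum_i \sum_j invmx (g c x) i j * A i j.

Definition scal c x : R := trace_g c x (ricci c x).

Definition einstein_tensor c x : 'M[R]_n :=
  ricci c x - (2^-1 * scal c x) *: g c x.

(* The (i, j) entry is nabla_i theta_j. *)
Definition nabla theta c x : 'M[R]_n :=
  \matrix_(i, j) (partial i (fun y => theta c y 0 j) x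
                  - \sum_k christoffel c k i j x * theta c x 0 k).

Definition codiff theta c x : R := - trace_g c x (nabla theta c x).

Definition delta_star theta c x : 'M[R]_n :=
  2^-1 *: (nabla theta c x + (nabla theta c x)^T).

Definition Bstar theta c x : 'M[R]_n :=
  delta_star theta c x + (2^-1 * codiff theta c x) *: g c x.

Definition hess f c x : 'M[R]_n := nabla (differential f) c x.

Definition laplacian f c x : R := trace_g c x (hess f c x).

Definition borel : measurableType _ :=
  g_sigma_algebraType [set U : set M | open U].

Definition chart_volume c (A : set M) : \bar R :=
  lebesgue_integral_rV (fun x =>
    (\1_(cimg c `&` cinv c @^-1` A) x * Num.sqrt (\det (g c x)))%:E).

(* dv_g: the Borel measure of M given by sqrt(det g) dx in every chart. Its
   value on A is the supremum of the volumes of the finite families of pairwise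
   disjoint Borel pieces of A, each contained in the domain of a chart. *)
Definition volume (A : set borel) : \bar R :=
  ereal_sup [set v | exists (k : nat) (c : 'I_k -> chart R n M)
                            (B : 'I_k -> set M),
    [/\ forall i, atlas X (c i) /\ measurable (B i : set borel),
        forall i, B i `<=` A `&` cdom (c i),
        trivIset [set: 'I_k] B &
        v = (\sum_(i < k) chart_volume (c i) (B i))%E]].

(* The value of [scal] at a point does not depend on the chart. *)
Definition scal_fun (p : M) : R := scal (chart_at X p) (cmap (chart_at X p) p).

Definition scal_average : R :=
  fine (\int[volume]_p (scal_fun p)%:E)%E / fine (volume [set: borel]).

Definition chen_nagano theta : Prop :=
  in_charts X (fun c x =>
    einstein_tensor c x
    = Bstar theta c x - ((n%:R - 2) / (2 * n%:R) * scal_average) *: g c x).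

Definition constant_scal : Prop :=
  exists k : R, in_charts X (fun c x => scal c x = k).

Definition einstein_metric : Prop :=
  exists mu : R, in_charts X (fun c x => ricci c x = mu *: g c x).

Definition soliton_lambda f c x : R :=
  - ((n%:R - 2) / (2 * n%:R) * scal_average)
  + 2^-1 * scal c x - 2^-1 * laplacian f c x.

Definition ricci_almost_soliton f (lambda : chart R n M -> 'rV[R]_n -> R) :=
  in_charts X (fun c x => ricci c x - hess f c x = lambda c x *: g c x).

Definition constant_function f : Prop := exists k : R, forall p, f p = k.

(* Constancy of f is the definition; the second clause is its consequence, that
   the equation reduces to the Einstein equation with constant lambda. *)
Definition trivial_soliton f (lambda : chart R n M -> 'rV[R]_n -> R) : Prop :=
  constant_function f /\
  exists l : R, in_charts X (fun c x =>
    [/\ hess f c x = 0, lambda c x = l & ricci c x = l *: g c x]).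

End riemannian.

(* Main.v *)
Require Import Defs.
From mathcomp Require Import ring lra.

(* Tracing the critical equation gives [Delta f = s - sbar], which is constant.
   Up to replacing [f] by [-f], this constant is nonnegative, so that [f] is
   subharmonic; it attains its maximum by compactness, and Hopf's strong maximum
   principle in charts makes the set of maximum points open.  Hence [f] is
   constant by connectedness, [Hess f = 0], and the critical equation becomes
   the Einstein equation. *)

Set Implicit Arguments.
Unset Strict Implicit.
Unset Printing Implicit Defensive.

Local Open Scope classical_set_scope.
Local Open Scope ring_scope.

(** The maximum principle takes the place of integrating [Delta f] over [M]: it works pointwise,
    with [sbar] entering only as a constant. In a chart [Delta] is [g^{ij} d_i d_j] plus a
    first-order term, with continuous coefficients and positive definite leading part. Two
    mismatches shape the analysis. Smoothness is expressed by partial derivatives along basis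
    vectors, whereas the second derivative test needs every direction; continuity of the partials
    bridges this. Hopf's argument needs round balls, whereas the norm of row vectors is the max
    norm; hence a separate Euclidean product [dot] and dimensional constants when the two are
    compared. The barrier is a polynomial instead of the usual exponential, so that its derivatives
    are explicit. *)

Section continuity_at_a_point.
Variables (R : realType) (T : topologicalType) (x : T).
Implicit Types f g : T -> R.

Lemma for_continuousD f g : {for x, continuous f} -> {for x, continuous g} ->
  {for x, continuous (fun y => f y + g y)}.
Proof. exact: cvgD. Qed.

Lemma for_continuousN f : {for x, continuous f} ->
  {for x, continuous (fun y => - f y)}.
Proof. exact: cvgN. Qed.

Lemma for_continuousM f g : {for x, continuous f} -> {for x, continuous g} ->
  {for x, continuous (fun y => f y * g y)}.
Proof. exact: cvgM. Qed.

Lemma for_continuous_cst (a : R) : {for x, continuous (fun _ : T => a)}.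
Proof. exact: cvg_cst. Qed.

Lemma for_continuous_sum (I : Type) (r : seq I) (P : pred I) (F : I -> T -> R) :
  (forall i, P i -> {for x, continuous (F i)}) ->
  {for x, continuous (fun y => \sum_(i <- r | P i) F i y)}.
Proof. by move=> H; apply: (cvg_big add_continuous). Qed.

Lemma for_continuous_prod (I : Type) (r : seq I) (P : pred I) (F : I -> T -> R) :
  (forall i, P i -> {for x, continuous (F i)}) ->
  {for x, continuous (fun y => \prod_(i <- r | P i) F i y)}.
Proof. by move=> H; apply: (cvg_big mul_continuous). Qed.

End continuity_at_a_point.

(** * Differentiability from continuous partials, and the second derivative test *)

Section directional_derivatives.
Variables (R : realType) (n : nat).
Implicit Types (u : 'rV[R]_n -> R) (x y v : 'rV[R]_n).

Lemma is_derive_line u x v (t a : R) :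
  is_derive (t *: v + x) v u a -> is_derive t 1 (fun s : R => u (s *: v + x)) a.
Proof.
have E : (fun h : R => h^-1 *: (((fun s : R => u (s *: v + x)) \o shift t) (h *: 1)
                             - u (t *: v + x)))
       = (fun h : R => h^-1 *: ((u \o shift (t *: v + x)) (h *: v)
                             - u (t *: v + x))).
  by apply/funext => h /=; rewrite [h *: 1]mulr1 scalerDl addrA.
move=> [dU vU]; split; first by rewrite /derivable E.
by rewrite /derive E.
Qed.

Lemma MVT_line u (d : 'rV[R]_n -> R) x v (a b : R) : a <= b ->
  (forall t, a <= t <= b -> is_derive (t *: v + x) v u (d (t *: v + x))) ->
  exists2 c, a <= c <= b &
    u (b *: v + x) - u (a *: v + x) = d (c *: v + x) * (b - a).
Proof.
move=> ab du.
have [t tab||c cab E] :=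
    @MVT_segment R (fun s => u (s *: v + x)) (fun s => d (s *: v + x)) a b ab.
- by apply: is_derive_line; apply: du; rewrite !ltW ?(itvP tab).
- apply: derivable_within_continuous => t tab.
  by have [] := is_derive_line (du t _) => //; rewrite !(itvP tab).
- by exists c => //; rewrite !(itvP cab).
Qed.

(** One coordinate step of [partials_expansion]: the mean value theorem turns a bound on the
    variation of [d] along a segment into a bound on the remainder. *)
Lemma partial_increment_le u (d : 'rV[R]_n -> R) x v (s L e : R) :
  (forall t, `|t| <= `|s| ->
     is_derive (t *: v + x) v u (d (t *: v + x)) /\ `|d (t *: v + x) - L| <= e) ->
  `|u (s *: v + x) - u x - s * L| <= e * `|s|.
Proof.
move=> H; have x0 : x = 0 *: v + x by rewrite scale0r add0r.
have [c cs ->] : exists2 c, `|c| <= `|s| & u (s *: v + x) - u x = d (c *: v + x) * s.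
  have [s0|s0] := leP 0 s.
    have [t /andP[t0 ts]|c /andP[c0 cs]] := @MVT_line u d x v 0 s s0.
      by have [] := H t; rewrite // !ger0_norm.
    rewrite -x0 subr0 => ->; exists c => //; rewrite !ger0_norm //.
  have [t /andP[t0 ts]|c /andP[c0 cs]] := @MVT_line u d x v s 0 (ltW s0).
    by have [] := H t; rewrite // !ler0_norm ?lerN2 // ltW.
  rewrite -x0 sub0r mulrN => E; exists c; last by rewrite -[RHS]opprK -E opprB.
  by rewrite !ler0_norm ?lerN2 // ltW.
rewrite mulrC -mulrBr normrM mulrC ler_wpM2r //.
by have [] := H c cs.
Qed.


Lemma rV_norm_le x (e : R) : 0 <= e -> (`|x| <= e) <-> (forall i, `|x 0 i| <= e).
Proof.
move=> e0; rewrite [`|x|]mx_normrE; split=> [/bigmax_leP[_ H] i|H].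
  exact: (H (0, i)).
by apply/bigmax_leP; split=> // -[i j] _ /=; rewrite (ord1 i).
Qed.

Lemma rV_coord_le x i : `|x 0 i| <= `|x|.
Proof. by apply: (rV_norm_le _ _).1 i. Qed.

Lemma partials_expansion u (d : 'I_n -> 'rV[R]_n -> R) x (e : R) :
  (\forall y \near x, forall i, is_derive y (delta_mx 0 i) u (d i y)) ->
  (forall i, {for x, continuous (d i)}) -> 0 < e ->
  \forall y \near x,
    `|u y - u x - \sum_i (y - x) 0 i * d i x| <= n%:R * e * `|y - x|.
Proof.
move=> du cd e0.
have cd' : \forall y \near x, forall i, `|d i y - d i x| <= e.
  apply: (@filter_forall _ _ (fun i y => `|d i y - d i x| <= e) (nbhs x) _) => i.
  have /cvgrPdist_le/(_ _ e0) := cd i.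
  by apply: filterS => y; rewrite distrC.
have [r /= r0 Hr] := (nbhs_ballP _ _).1 (filterI du cd').
apply/nbhs_ballP; exists r => //= y; rewrite -ball_normE /= distrC => yr.
(* The path from [x] to [y] through the points [p k] changes one coordinate at a time; in the max
   norm it never leaves the ball where the hypotheses hold. *)
pose p k : 'rV[R]_n := \row_i (if (i < k)%N then y 0 i else x 0 i).
have p0 : p 0%N = x by apply/rowP => i; rewrite mxE ltn0.
have pn : p n = y by apply/rowP => i; rewrite mxE ltn_ord.
have pS (k : 'I_n) : p k.+1 = (y - x) 0 k *: delta_mx 0 k + p k.
  apply/rowP => i; rewrite !mxE ltnS eqxx /= leq_eqVlt.
  have [ik|ik] := eqVneq i k; first by rewrite ik eqxx ltnn /= mulr1 subrK.
  by rewrite (negbTE (_ : val i != val k)) //= mulr0 add0r.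
have inc (k : 'I_n) : `|u (p k.+1) - u (p k) - (y - x) 0 k * d k x| <= e * `|y - x|.
  rewrite pS; apply: (@le_trans _ _ (e * `|(y - x) 0 k|)); last first.
    by rewrite ler_pM2l // rV_coord_le.
  apply: (@partial_increment_le _ (d k)) => t tk.
  suff /Hr[+ +] : ball x r (t *: delta_mx 0 k + p k) by move=> /(_ k) ? /(_ k).
  rewrite -ball_normE /= distrC; apply: le_lt_trans yr.
  apply/rV_norm_le => // i; rewrite !mxE eqxx /=.
  have [->|ik] := eqVneq i k.
    by rewrite ltnn mulr1 addrK (le_trans tk) // rV_coord_le.
  rewrite mulr0 add0r; case: ifP => _; last by rewrite subrr normr0.
  by have := rV_coord_le (y - x) i; rewrite !mxE.
have -> : u y - u x = \sum_(k < n) (u (p k.+1) - u (p k)).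
  by rewrite -(big_mkord xpredT (fun k => u (p k.+1) - u (p k))) telescope_sumr // p0 pn.
rewrite -sumrB (le_trans (ler_norm_sum _ _ _)) //.
apply: (le_trans (ler_sum _ (fun k _ => inc k))).
by rewrite sumr_const card_ord -[X in X <= _]mulr_natl mulrA.
Qed.

(** Along [h *: v + x] the remainder in [partials_expansion] is [o(h)], which extends the
    derivatives from basis vectors to all directions. *)
Lemma is_derive_partials u (d : 'I_n -> 'rV[R]_n -> R) x v :
  (\forall y \near x, forall i, is_derive y (delta_mx 0 i) u (d i y)) ->
  (forall i, {for x, continuous (d i)}) ->
  is_derive x v u (\sum_i v 0 i * d i x).
Proof.
move=> du cd; set L := \sum_i _.
suff H : (fun h : R => h^-1 *: ((u \o shift x) (h *: v) - u x)) @ 0^' --> L.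
  by split; [apply/cvg_ex; exists L | exact: cvg_lim].
apply/cvgrPdist_le => e e0.
(* The summand 1 keeps [C] positive when [v = 0]; with tolerance [e / C] the remainder divided by
   [|h|] is at most [e]. *)
pose C := n%:R * `|v| + 1; have C0 : 0 < C by rewrite ltr_wpDl // mulr_ge0.
have /partials_expansion/(_ cd (divr_gt0 e0 C0)) := du.
have shx : (fun h : R => h *: v + x) @ 0^' --> x.
  have : (fun h : R => h *: v + x) @ 0 --> 0 *: v + x.
    by apply: cvgD; [apply: cvgZr_tmp; exact: cvg_id|exact: cvg_cst].
  by rewrite scale0r add0r => H; apply: cvg_trans H; apply: cvg_app; exact: cvg_within.
move=> /shx E; near=> h.
have h0 : h != 0 by near: h; exact: nbhs_dnbhs_neq.
have /= : `|u (h *: v + x) - u x - \sum_i (h *: v + x - x) 0 i * d i x|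
     <= n%:R * (e / C) * `|h *: v + x - x| by near: h; exact: E.
rewrite addrK; under eq_bigr do rewrite mxE -mulrA; rewrite -mulr_sumr -/L normrZ => H.
have -> : L - h^-1 *: (u (h *: v + x) - u x)
        = - h^-1 * (u (h *: v + x) - u x - h * L).
  rewrite [h^-1 *: _]/(h^-1 * _) [RHS]mulrBr [_ * (h * L)]mulrA [- h^-1 * h]mulNr.
  by rewrite mulVf // mulN1r opprK mulNr addrC.
rewrite normrM normrN normfV ler_pdivrMl ?normr_gt0 // (le_trans H) //.
rewrite mulrCA ler_wpM2l // mulrAC mulrA ler_pdivrMr // mulrC ler_pM2l //.
by rewrite lerDl.
Unshelve. all: by end_near. Qed.

(** If [L > 0], then [df], which vanishes at 0, is positive just to the right of 0, and the mean
    value theorem gives [f t > f 0] for small [t > 0]. *)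
Lemma derive_local_max (f df : R -> R) (L : R) :
  (\forall t \near (0 : R), is_derive t (1 : R) f (df t)) -> is_derive (0 : R) 1 df L ->
  (\forall t \near (0 : R), f t <= f 0) -> df 0 = 0 /\ L <= 0.
Proof.
move=> Df [ddf Ldf] fmax.
have [r /= r0 Hr] := (nbhs_ballP _ _).1 (filterI Df fmax).
have inr (t : R) : `|t| < r -> is_derive t 1 f (df t) /\ f t <= f 0.
  by move=> tr; apply: Hr; rewrite /ball /= sub0r normrN.
have df0 : df 0 = 0.
  have [_ D0] : is_derive (0 : R) 1 f 0.
    apply: (@derive1_at_max R f (- r) r); rewrite ?in_itv /= ?oppr_lt0 ?r0 //.
    - by rewrite ltW // (lt_trans _ r0) // oppr_lt0.
    - by move=> t; rewrite in_itv /= -ltr_norml => /inr[[]].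
    - by move=> t; rewrite in_itv /= -ltr_norml => /inr[].
  by have [|[_ <-] _] := inr 0; rewrite ?normr0.
split=> //; rewrite leNgt; apply/negP => L0.
have dL : (fun h : R => h^-1 *: ((df \o shift 0) (h *: 1) - df 0)) @ 0^' --> L.
  by rewrite -Ldf; exact: ddf.
have := cvgr_gt L dL 0 L0; rewrite near_withinE => /= pos.
have [s /= s0 Hs] := (nbhs_ballP _ _).1 (pos _).
pose t := Num.min r s / 2.
have rs0 : 0 < Num.min r s by rewrite lt_min r0.
have t0 : 0 < t by rewrite divr_gt0.
have tlt : t < Num.min r s by rewrite gtr_pMr // invf_lt1 // ltr1n.
have [tr ts] : t < r /\ t < s by apply/andP; rewrite -lt_min.
have [||c] := @MVT R f df 0 t t0.
- move=> c; rewrite in_itv /= => /andP[c0 ct]; apply: (inr c _).1.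
  by rewrite gtr0_norm // (lt_trans ct).
- apply: derivable_within_continuous => c; rewrite in_itv /= => /andP[c0 ct].
  by apply: (inr c _).1.(ex_derive); rewrite ger0_norm // (le_lt_trans ct).
rewrite in_itv /= => /andP[c0 ct] E.
have : 0 < df c.
  have := Hs c; rewrite /ball /= sub0r normrN gtr0_norm // => /(_ (lt_trans ct ts)).
  rewrite gt_eqF // => /(_ isT); rewrite [c *: 1]mulr1 addr0 df0 subr0 /GRing.scale /=.
  by rewrite pmulr_rgt0 // invr_gt0.
rewrite -(pmulr_lgt0 _ t0) -[X in _ * X]subr0 -E subr_gt0 ltNge.
by rewrite (inr t _).2 // gtr0_norm.
Qed.

(** Restriction to the lines [t *: v + p] reduces this to [derive_local_max]; basis vectors [v]
    yield the vanishing of the gradient. *)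
Lemma second_derivative_test u (d1 : 'I_n -> 'rV[R]_n -> R)
    (d2 : 'I_n -> 'I_n -> 'rV[R]_n -> R) p :
  (\forall y \near p, forall j, is_derive y (delta_mx 0 j) u (d1 j y)) ->
  (\forall y \near p, forall i j, is_derive y (delta_mx 0 i) (d1 j) (d2 i j y)) ->
  (\forall y \near p, forall j, {for y, continuous (d1 j)}) ->
  (forall i j, {for p, continuous (d2 i j)}) ->
  (\forall y \near p, u y <= u p) ->
  (forall j, d1 j p = 0) /\
  (forall v : 'rV[R]_n, \sum_i \sum_j v 0 i * v 0 j * d2 i j p <= 0).
Proof.
move=> D1 D2 c1 c2 pmax.
have dir v : \sum_i v 0 i * d1 i p = 0 /\ \sum_i \sum_j v 0 i * v 0 j * d2 i j p <= 0.
  pose D y := \sum_i v 0 i * d1 i y.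
  have DD : is_derive p v D (\sum_i v 0 i * \sum_j v 0 j * d2 i j p).
    apply: (@is_derive_partials D (fun i y => \sum_j v 0 j * d2 i j y)).
      apply: filterS D2 => y D2y i.
      have -> : D = \sum_j (v 0 j \*: d1 j) by apply/funext => z; rewrite fct_sumE.
      by apply: is_derive_sum => j; exact: is_deriveZ.
    move=> i; apply: for_continuous_sum => j _.
    by apply: for_continuousM => //; exact: for_continuous_cst.
  have lp : (fun t : R => t *: v + p) @ 0 --> p.
    have : (fun h : R => h *: v + p) @ 0 --> 0 *: v + p.
      by apply: cvgD; [apply: cvgZr_tmp; exact: cvg_id|exact: cvg_cst].
    by rewrite scale0r add0r.
  have [] := @derive_local_max (fun t => u (t *: v + p)) (fun t => D (t *: v + p))
     (\sum_i v 0 i * \sum_j v 0 j * d2 i j p).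
  (* [near_join] is there because [is_derive_partials] at [t *: v + p] asks for [D1] on a whole
     neighbourhood of that point. *)
  - apply: (@filterS _ (nbhs (0 : R)) _ _ _ _ (lp _ (filterI (near_join D1) c1))).
    by move=> t [D1t c1t]; apply: is_derive_line; exact: is_derive_partials.
  - by apply: is_derive_line; rewrite scale0r add0r.
  - by rewrite scale0r add0r; have := lp _ pmax.
  rewrite {1}/D scale0r add0r => -> H; split=> //; apply: le_trans H.
  rewrite le_eqVlt; apply/orP; left; apply/eqP; apply: eq_bigr => i _.
  by rewrite mulr_sumr; apply: eq_bigr => j _; rewrite mulrA.
split=> [j|v]; last exact: (dir v).2.
rewrite -[RHS](dir (delta_mx 0 j)).1 (bigD1 j) //= mxE !eqxx mul1r big1 ?addr0 //.
by move=> i /negbTE ij; rewrite mxE ij andbF mul0r.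
Qed.

End directional_derivatives.

(** * Positive definite matrices and continuity of the inverse *)

Section positive_definite.
Variable R : realType.

Definition posdefmx n (A : 'M[R]_n) : Prop :=
  A^T = A /\ forall v : 'rV[R]_n, v != 0 -> 0 < (v *m A *m v^T) 0 0.

Lemma posdefmx_unit n (A : 'M[R]_n) : posdefmx A -> A \in unitmx.
Proof.
move=> [_ pos]; rewrite -row_free_unit -kermx_eq0; apply/negPn/negP.
move=> /rowV0Pn[v /sub_kermxP vA v0].
by have := pos v v0; rewrite vA mul0mx mxE ltxx.
Qed.

Lemma invmx_sym n (A : 'M[R]_n) : A^T = A -> (invmx A)^T = invmx A.
Proof. by move=> sA; rewrite trmx_inv sA. Qed.

(** With [w = v *m invmx A], the form of [invmx A] at [v] is the form of [A] at [w]. *)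
Lemma posdefmx_inv n (A : 'M[R]_n) : posdefmx A -> posdefmx (invmx A).
Proof.
move=> pA; have uA := posdefmx_unit pA; have [sA pos] := pA.
split=> [|v v0]; first exact: invmx_sym.
have w0 : v *m invmx A != 0.
  by apply: contraNneq v0 => H; rewrite -(mulmxKV uA v) H mul0mx.
by have := pos _ w0; rewrite mulmxKV // trmx_mul invmx_sym // mulmxA.
Qed.

(** Cholesky factorization, by induction on the size through the Schur complement [S] of the upper
    left entry. *)
Lemma posdefmx_gram n (A : 'M[R]_n) : posdefmx A -> exists B : 'M[R]_n, A = B^T *m B.
Proof.
elim: n A => [|n IH] A [sA pos]; first by exists 0; apply/matrixP => -[].
rewrite -[n.+1]/(1 + n)%N in A sA pos *.
pose a := ulsubmx A; pose b := ursubmx A; pose D := drsubmx A.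
have EA : A = block_mx a b b^T D.
  by rewrite -[LHS]submxK; congr block_mx; rewrite trmx_ursub sA.
have sD : D^T = D by rewrite trmx_drsub sA.
pose al := a 0 0; have Ea : a = al%:M by rewrite [LHS]mx11_scalar.
have al0 : 0 < al.
  have := pos (row_mx 1 0); rewrite row_mx_eq0 oner_eq0 => /(_ isT).
  rewrite EA mul_row_block !mul1mx !mul0mx !addr0 tr_row_mx trmx1 trmx0.
  by rewrite mul_row_col mulmx1 mulmx0 addr0.
pose S := D - al^-1 *: (b^T *m b).
have pS : posdefmx S.
  split=> [|w w0].
    by rewrite linearB linearZ /= trmx_mul trmxK sD.
  (* The first block is chosen so that the product with [A] is [row_mx 0 (w *m S)]; the form of [A]
     there is the form of [S] at [w]. *)
  have := pos (row_mx (- al^-1 *: (w *m b^T)) w).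
  rewrite row_mx_eq0 negb_and w0 orbT => /(_ isT).
  rewrite EA mul_row_block Ea mul_mx_scalar scalerA mulrN divff ?gt_eqF //.
  rewrite scaleN1r addNr tr_row_mx mul_row_col mul0mx add0r.
  rewrite /S mulmxBr mulmxBl -!scalemxAl -scalemxAr -scalemxAl !mulmxA scaleNr.
  by rewrite addrC mulmxDl mulNmx -scalemxAl.
have [C EC] := IH _ pS.
pose s := Num.sqrt al; have s0 : s != 0 by rewrite gt_eqF // sqrtr_gt0.
have ss : s * s = al by rewrite -expr2 sqr_sqrtr // ltW.
exists (block_mx s%:M (s^-1 *: b) 0 C).
rewrite tr_block_mx mulmx_block !trmx0 !mul0mx !mulmx0 !addr0 tr_scalar_mx.
rewrite [LHS]EA; congr block_mx.
- by rewrite -scalar_mxM ss.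
- by rewrite mul_scalar_mx scalerA divff // scale1r.
- by rewrite linearZ /= mul_mx_scalar scalerA divff // scale1r.
rewrite -scalemxAr [_^T]linearZ /= -scalemxAl scalerA -invfM ss -EC /S.
by rewrite addrCA subrr addr0.
Qed.

(** For [A = B^T *m B] the sum splits over the rows of [B] into values of the quadratic form [H]. *)
Lemma posdefmx_trace_le0 n (A : 'M[R]_n) (H : 'I_n -> 'I_n -> R) : posdefmx A ->
  (forall v : 'rV[R]_n, \sum_i \sum_j v 0 i * v 0 j * H i j <= 0) ->
  \sum_i \sum_j A i j * H i j <= 0.
Proof.
move=> /posdefmx_gram[B ->] Hle.
have -> : \sum_i \sum_j (B^T *m B) i j * H i j
        = \sum_k \sum_i \sum_j row k B 0 i * row k B 0 j * H i j.
  rewrite [RHS]exchange_big; apply: eq_bigr => i _.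
  rewrite [RHS]exchange_big; apply: eq_bigr => j _.
  rewrite mxE mulr_suml; apply: eq_bigr => k _; by rewrite !mxE.
by apply: sumr_le0 => k _; exact: Hle.
Qed.

Lemma posdefmx_sum_gt0 n (A : 'M[R]_n) (v : 'rV[R]_n) : posdefmx A -> v != 0 ->
  0 < \sum_i \sum_j A i j * (v 0 i * v 0 j).
Proof.
move=> [_ pos] /pos; rewrite mxE; congr (0 < _).
rewrite [RHS]exchange_big; apply: eq_bigr => j _; rewrite !mxE mulr_suml.
by apply: eq_bigr => i _; rewrite mulrA [A i j * _]mulrC.
Qed.

Lemma for_continuous_det (T : topologicalType) (x : T) n (A : T -> 'M[R]_n) :
  (forall i j, {for x, continuous (fun y => A y i j)}) ->
  {for x, continuous (fun y => \det (A y))}.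
Proof.
move=> cA; apply: for_continuous_sum => s _; apply: for_continuousM.
  exact: for_continuous_cst.
by apply: for_continuous_prod => i _.
Qed.

Lemma for_continuous_invmx (T : topologicalType) (x : T) n (A : T -> 'M[R]_n) :
  (forall i j, {for x, continuous (fun y => A y i j)}) -> A x \in unitmx ->
  forall i j, {for x, continuous (fun y => invmx (A y) i j)}.
Proof.
move=> cA uA i j.
have dA : \det (A x) != 0 by rewrite -unitfE -unitmxE.
have cd := for_continuous_det cA.
have nd : \forall y \near x, \det (A y) != 0 by exact: (cvgr_neq0 _ cd dA).
(* [invmx] returns its argument on singular matrices, so the cofactor formula [B] is compared with
   it only where the determinant is nonzero, which holds near [x]. *)
pose B y := (\det (A y))^-1 * ((-1) ^+ (j + i) * \det (row' j (col' i (A y)))).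
have E y : \det (A y) != 0 -> B y = invmx (A y) i j.
  by move=> d0; rewrite /B /invmx unitmxE unitfE d0 !mxE.
have : {for x, continuous B}.
  apply: for_continuousM; first exact: cvgV.
  apply: for_continuousM; first exact: for_continuous_cst.
  apply: for_continuous_det => k l.
  suff -> : (fun y => row' j (col' i (A y)) k l)
          = (fun y => A y (lift j k) (lift i l)) by [].
  by apply/funext => y; rewrite !mxE.
rewrite /prop_for /continuous_at E // => H; apply: cvg_trans H.
by apply: near_eq_cvg; apply: filterS nd => y /E.
Qed.

End positive_definite.

Section pointwise_derivation_rules.
Variables (R : realType) (n : nat) (x v : 'rV[R]_n).
Implicit Types f g : 'rV[R]_n -> R.

Lemma is_derive_fun_cst (a : R) : is_derive x v (fun _ => a) 0.
Proof. exact: is_derive_cst. Qed.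

Lemma is_derive_funD f g (a b : R) : is_derive x v f a -> is_derive x v g b ->
  is_derive x v (fun y => f y + g y) (a + b).
Proof. by move=> fa gb; exact: is_deriveD. Qed.

Lemma is_derive_funM f g (a b : R) : is_derive x v f a -> is_derive x v g b ->
  is_derive x v (fun y => f y * g y) (f x * b + g x * a).
Proof. by move=> fa gb; exact: is_deriveM. Qed.

Lemma is_derive_funZ f (k a : R) : is_derive x v f a ->
  is_derive x v (fun y => k * f y) (k * a).
Proof. by move=> fa; exact: is_deriveZ. Qed.

Lemma is_derive_fun_sum m (f : 'I_m -> 'rV[R]_n -> R) (a : 'I_m -> R) :
  (forall i, is_derive x v (f i) (a i)) ->
  is_derive x v (fun y => \sum_i f i y) (\sum_i a i).
Proof.
move=> fa; have -> : (fun y => \sum_i f i y) = \sum_i f i.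
  by apply/funext => y; rewrite fct_sumE.
exact: is_derive_sum.
Qed.

Lemma is_derive_coord i : is_derive x v (fun y : 'rV[R]_n => y 0 i) (v 0 i).
Proof.
have dx : derivable (id : 'rV[R]_n -> 'rV[R]_n) x v by exact: derivable_id.
split; first exact: ((derivable_mxP _ _ _).1 dx 0 i).
by have := derive_mx dx; rewrite derive_id => /matrixP /(_ 0 i); rewrite mxE.
Qed.

End pointwise_derivation_rules.

(** * Closed and compact subsets of a chart image *)

Section closed_sets.
Variables (R : realType).

(** A function read in a chart is known to be continuous only on the chart image; its level sets
    become closed after intersection with a closed set inside that image. *)
Lemma closed_setI_preimage (T : topologicalType) (D : set T) (f : T -> R) (C : set R) :
  closed D -> closed C -> (forall x, D x -> {for x, continuous f}) ->
  closed (D `&` f @^-1` C).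
Proof.
move=> cD cC cf x clx.
have Dx : D x by apply: cD; apply: closure_subset clx; exact: subIsetl.
split=> //; apply: cC => B /(cf x Dx) fB.
by have [y [[_ Cy] By]] := clx _ fB; exists (f y).
Qed.

Lemma closed_norm_le n (z : 'rV[R]_n) (r : R) : closed [set x | `|x - z| <= r].
Proof.
have -> : [set x | `|x - z| <= r] = setT `&` (fun x => `|x - z|) @^-1` [set s | s <= r].
  by rewrite setTI.
apply: closed_setI_preimage => [||x _].
- exact: closedT.
- exact: closed_le.
have cB : (fun y => y - z) @ nbhs x --> x - z.
  by apply: cvgB; [exact: cvg_id|exact: cvg_cst].
exact: cvg_norm cB.
Qed.

Lemma compact_norm_le n (z : 'rV[R]_n) (r : R) (C : set 'rV[R]_n) :
  closed C -> C `<=` [set x | `|x - z| <= r] -> compact C.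
Proof.
move=> cC Cr; apply: bounded_closed_compact => //.
exists (`|z| + r); split; first exact: num_real.
move=> s zs x /Cr /= xz; apply: le_trans (ltW zs).
by rewrite -[x](subrK z) addrC (le_trans (ler_normD _ _)) // lerD2l.
Qed.

End closed_sets.

(** * The barrier for Hopf's argument *)

Section hopf.
Variables (R : realType) (n : nat).
Implicit Types (x y z e : 'rV[R]_n).

(** The Euclidean product, kept apart from the norm of row vectors because the touching balls must
    be round. *)
Definition dot x y : R := \sum_i x 0 i * y 0 i.

Lemma dot_gt0 x : x != 0 -> 0 < dot x x.
Proof.
move=> x0; have [i xi] : exists i, x 0 i != 0.
  by apply/rV0Pn.
rewrite /dot (bigD1 i) //= ltr_pwDl //; first by rewrite -expr2 exprn_even_gt0.
by apply: sumr_ge0 => j _; rewrite -expr2 sqr_ge0.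
Qed.

Variables (e z : 'rV[R]_n) (al : R).

(* A quadratic barrier vanishing at [z]: the rank-one term makes [L barrier]
   positive near [z] for [al] large, whatever the drift of [L], while the barrier
   stays negative outside the ball centered at [z + e] through [z]. *)
Definition barrier x : R :=
  2 * dot e (x - z) - 2 * dot (x - z) (x - z) + al * dot e (x - z) ^+ 2.

Definition barrier1 j x : R :=
  2 * e 0 j - 4 * (x - z) 0 j + 2 * al * dot e (x - z) * e 0 j.

Definition barrier2 (i j : 'I_n) (x : 'rV[R]_n) : R :=
  - 4 * (i == j)%:R + 2 * al * e 0 i * e 0 j.

Lemma is_derive_shifted_coord x i j :
  is_derive x (delta_mx 0 i) (fun y : 'rV[R]_n => (y - z) 0 j) (i == j)%:R.
Proof.
have -> : (fun y : 'rV[R]_n => (y - z) 0 j) = (fun y : 'rV[R]_n => y 0 j + - z 0 j).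
  by apply/funext => y; rewrite !mxE.
apply: is_derive_eq (is_derive_funD (is_derive_coord _ _ _) (is_derive_fun_cst _ _ _)) _.
by rewrite addr0 mxE eqxx eq_sym.
Qed.

Lemma sum_delta (F : 'I_n -> R) i : \sum_j F j * (i == j)%:R = F i.
Proof.
rewrite (bigD1 i) //= eqxx mulr1 big1 ?addr0 // => j ji.
by rewrite eq_sym (negbTE ji) mulr0.
Qed.

Lemma is_derive_dot_shift x i :
  is_derive x (delta_mx 0 i) (fun y => dot e (y - z)) (e 0 i).
Proof.
have H : is_derive x (delta_mx 0 i) (fun y => dot e (y - z)) (\sum_j e 0 j * (i == j)%:R).
  apply: is_derive_fun_sum => j; apply: is_derive_funZ.
  exact: is_derive_shifted_coord.
by rewrite sum_delta in H.
Qed.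

Lemma is_derive_barrier x i : is_derive x (delta_mx 0 i) barrier (barrier1 i x).
Proof.
have H1 : is_derive x (delta_mx 0 i) (fun y => dot (y - z) (y - z))
     (\sum_j ((x - z) 0 j * (i == j)%:R + (x - z) 0 j * (i == j)%:R)).
  apply: is_derive_fun_sum => j.
  by apply: is_derive_funM; exact: is_derive_shifted_coord.
have H2 := is_derive_dot_shift x i.
have H := is_derive_funD (is_derive_funD (is_derive_funZ 2 H2) (is_derive_funZ (- 2) H1))
            (is_derive_funZ al (is_derive_funM H2 H2)).
have -> : barrier = (fun y => 2 * dot e (y - z) + - 2 * dot (y - z) (y - z)
                            + al * (dot e (y - z) * dot e (y - z))).
  by apply/funext => y; rewrite /barrier expr2 mulNr.
apply: is_derive_eq H _; rewrite big_split /= sum_delta /barrier1; ring.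
Qed.

Lemma is_derive_barrier1 x i j :
  is_derive x (delta_mx 0 i) (barrier1 j) (barrier2 i j x).
Proof.
have H1 := is_derive_dot_shift x i.
have H := is_derive_funD (is_derive_funD (is_derive_fun_cst x (delta_mx 0 i) (2 * e 0 j))
             (is_derive_funZ (- 4) (is_derive_shifted_coord x i j)))
            (is_derive_funZ (2 * al * e 0 j) H1).
have -> : barrier1 j = (fun y => 2 * e 0 j + - 4 * (y - z) 0 j
                            + 2 * al * e 0 j * dot e (y - z)).
  by apply/funext => y; rewrite /barrier1; ring.
by apply: is_derive_eq H _; rewrite /barrier2; ring.
Qed.

Lemma continuous_shifted_coord x j : {for x, continuous (fun y => (y - z) 0 j)}.
Proof.
have -> : (fun y : 'rV[R]_n => (y - z) 0 j) = (fun y : 'rV[R]_n => y 0 j + - z 0 j).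
  by apply/funext => y; rewrite !mxE.
by apply: for_continuousD; [exact: coord_continuous|exact: for_continuous_cst].
Qed.

Lemma continuous_dot_shift x : {for x, continuous (fun y => dot e (y - z))}.
Proof.
apply: for_continuous_sum => j _; apply: for_continuousM.
  exact: for_continuous_cst.
exact: continuous_shifted_coord.
Qed.

Lemma continuous_barrier x : {for x, continuous barrier}.
Proof.
have -> : barrier = (fun y => 2 * dot e (y - z) + - 2 * dot (y - z) (y - z)
                            + al * (dot e (y - z) * dot e (y - z))).
  by apply/funext => y; rewrite /barrier expr2 mulNr.
have H := @continuous_dot_shift x.
apply: for_continuousD; [apply: for_continuousD|]; apply: for_continuousM;
  try exact: for_continuous_cst; try exact: H.
  apply: for_continuous_sum => j _.
  by apply: for_continuousM; exact: continuous_shifted_coord.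
exact: for_continuousM.
Qed.

Lemma continuous_barrier1 x j : {for x, continuous (barrier1 j)}.
Proof.
have -> : barrier1 j = (fun y => 2 * e 0 j + - 4 * (y - z) 0 j
                            + 2 * al * e 0 j * dot e (y - z)).
  by apply/funext => y; rewrite /barrier1; ring.
apply: for_continuousD; [apply: for_continuousD|]; try exact: for_continuous_cst;
  apply: for_continuousM; try exact: for_continuous_cst.
  exact: continuous_shifted_coord.
exact: continuous_dot_shift.
Qed.

Lemma barrier_center : barrier z = 0.
Proof.
by rewrite /barrier /dot subrr !big1 ?expr0n /= => *;
  rewrite ?mxE ?mulr0 ?subrr ?addr0.
Qed.

(** With [p = x - z], the part [2 * dot e p - 2 * dot p p] is nonnegative exactly on the ball of
    centre [z + e/2] through [z], which meets the sphere of centre [z + e] only at [z]. The gap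
    between the two absorbs the rank-one term, which is at most [|dot e p|]. *)
Lemma barrier_lt0 x : x != z -> 2 * dot e (x - z) <= dot (x - z) (x - z) ->
  al * `|dot e (x - z)| <= 1 -> barrier x < 0.
Proof.
rewrite /barrier -subr_eq0 => /dot_gt0; set p := dot e _; set s := dot _ _ => s0 ps ap.
have : al * p ^+ 2 <= `|p|.
  by rewrite -[p ^+ 2]real_normK ?num_real // expr2 mulrA ler_piMl.
by have [p0|p0] := leP 0 p; [rewrite ger0_norm|rewrite ltr0_norm] => //; lra.
Qed.

End hopf.

(** * The strong maximum principle for second-order elliptic operators *)

Section strong_maximum_principle.
Variables (R : realType) (n : nat) (U : set 'rV[R]_n).
Variables (a : 'rV[R]_n -> 'M[R]_n) (b : 'I_n -> 'rV[R]_n -> R).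
Variables (u : 'rV[R]_n -> R) (d1 : 'I_n -> 'rV[R]_n -> R).
Variables (d2 : 'I_n -> 'I_n -> 'rV[R]_n -> R) (m : R).

(** Gradient and Hessian are independent arguments, so that linearity is a statement about finite
    sums, separate from differentiation. *)
Definition elliptic_op (w1 : 'I_n -> 'rV[R]_n -> R)
    (w2 : 'I_n -> 'I_n -> 'rV[R]_n -> R) (x : 'rV[R]_n) : R :=
  \sum_i \sum_j a x i j * w2 i j x + \sum_k b k x * w1 k x.

Hypothesis U_open : open U.
Hypothesis a_posdef : forall x, U x -> posdefmx (a x).
Hypothesis a_cont : forall x, U x -> forall i j, {for x, continuous (fun y => a y i j)}.
Hypothesis b_cont : forall x, U x -> forall k, {for x, continuous (b k)}.
Hypothesis u_cont : forall x, U x -> {for x, continuous u}.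
Hypothesis d1_cont : forall x, U x -> forall j, {for x, continuous (d1 j)}.
Hypothesis d2_cont : forall x, U x -> forall i j, {for x, continuous (d2 i j)}.
Hypothesis u_derive : forall x, U x -> forall j, is_derive x (delta_mx 0 j) u (d1 j x).
Hypothesis d1_derive : forall x, U x -> forall i j,
  is_derive x (delta_mx 0 i) (d1 j) (d2 i j x).
Hypothesis u_subsolution : forall x, U x -> 0 <= elliptic_op d1 d2 x.
Hypothesis u_le : forall x, U x -> u x <= m.

Lemma elliptic_opD w1 w2 v1 v2 (k : R) x :
  elliptic_op (fun j y => w1 j y + k * v1 j y) (fun i j y => w2 i j y + k * v2 i j y) x
  = elliptic_op w1 w2 x + k * elliptic_op v1 v2 x.
Proof.
rewrite /elliptic_op mulrDr !mulr_sumr addrACA; congr (_ + _); rewrite -big_split /=.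
  apply: eq_bigr => i _; rewrite mulr_sumr -big_split; apply: eq_bigr => j _ /=.
  by rewrite mulrDr mulrCA.
by apply: eq_bigr => i _ /=; rewrite mulrDr mulrCA.
Qed.

(** The gradient of the rank-one term vanishes at [z], so [al] multiplies only the form of [a z] at
    [e], positive by ellipticity; a large [al] then beats the other terms. *)
Lemma elliptic_op_barrier_center e z al :
  elliptic_op (barrier1 e z al) (barrier2 e al) z =
  (- 4 * \sum_i a z i i + 2 * \sum_k b k z * e 0 k)
  + al * (2 * \sum_i \sum_j a z i j * (e 0 i * e 0 j)).
Proof.
rewrite /elliptic_op addrAC; congr (_ + _).
  rewrite !mulr_sumr -big_split /=; apply: eq_bigr => i _.
  under eq_bigr do rewrite mulrDr; rewrite big_split /=; congr (_ + _).
    transitivity (\sum_j (- 4 * a z i j) * (i == j)%:R); last by rewrite sum_delta.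
    by apply: eq_bigr => j _; ring.
  by rewrite !mulr_sumr; apply: eq_bigr => j _; ring.
rewrite mulr_sumr; apply: eq_bigr => k _; rewrite /barrier1.
have -> : dot e (z - z) = 0 by rewrite /dot big1 // => i _; rewrite subrr mxE mulr0.
by rewrite !mxE; ring.
Qed.

Lemma continuous_elliptic_op_barrier e z al x : U x ->
  {for x, continuous (elliptic_op (barrier1 e z al) (barrier2 e al))}.
Proof.
move=> Ux; apply: for_continuousD.
  apply: for_continuous_sum => i _; apply: for_continuous_sum => j _.
  by apply: for_continuousM; [exact: a_cont|exact: for_continuous_cst].
apply: for_continuous_sum => k _; apply: for_continuousM; first exact: b_cont.
exact: continuous_barrier1.
Qed.

(** The vanishing gradient kills the drift; what remains is the trace of a positive definite matrix
    against a nonpositive Hessian. *)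
Lemma elliptic_op_le0_at_max (w : 'rV[R]_n -> R) w1 w2 p : U p ->
  (forall x, U x -> forall j, is_derive x (delta_mx 0 j) w (w1 j x)) ->
  (forall x, U x -> forall i j, is_derive x (delta_mx 0 i) (w1 j) (w2 i j x)) ->
  (forall x, U x -> forall j, {for x, continuous (w1 j)}) ->
  (forall i j, {for p, continuous (w2 i j)}) ->
  (\forall x \near p, w x <= w p) -> elliptic_op w1 w2 p <= 0.
Proof.
move=> Up D1 D2 c1 c2 pmax.
have Unear : nbhs p U by exact: open_nbhs_nbhs.
have [] := @second_derivative_test R n w w1 w2 p.
- exact: filterS Unear.
- exact: filterS Unear.
- exact: filterS Unear.
- exact: c2.
- exact: pmax.
move=> w10 w2le; rewrite /elliptic_op [X in _ + X]big1 ?addr0 => [|k _]; last first.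
  by rewrite w10 mulr0.
exact: posdefmx_trace_le0 (a_posdef Up) w2le.
Qed.

(* Hopf's touching argument: [{u = m}] cannot touch at [z], from outside, the
   ball centered at [z + e] whose boundary contains [z]. *)
Lemma hopf_no_touching (z e : 'rV[R]_n) : U z -> u z = m -> e != 0 ->
  (\forall x \near z, u x = m -> 2 * dot e (x - z) <= dot (x - z) (x - z)) -> False.
Proof.
move=> Uz uz e0 touch.
pose c : R := - 4 * \sum_i a z i i + 2 * \sum_k b k z * e 0 k.
pose q := 2 * \sum_i \sum_j a z i j * (e 0 i * e 0 j).
have q0 : 0 < q by rewrite mulr_gt0 // posdefmx_sum_gt0 //; exact: a_posdef.
(* Chosen so that [al * q = |c| + 1], whence [Lv z = c + |c| + 1 > 0]. *)
pose al : R := (`|c| + 1) / q; pose v := barrier e z al.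
have al0 : 0 < al by rewrite divr_gt0 // ltr_wpDl.
pose Lv := elliptic_op (barrier1 e z al) (barrier2 e al).
have Lvz : 0 < Lv z.
  rewrite /Lv elliptic_op_barrier_center -/c -/q divfK ?gt_eqF //.
  by have := ler_norm (- c); rewrite normrN; lra.
have Lvnear : \forall x \near z, 0 < Lv x.
  exact: (cvgr_gt _ (@continuous_elliptic_op_barrier e z al z Uz) _ Lvz).
have small : \forall x \near z, al * `|dot e (x - z)| <= 1.
  have C : {for z, continuous (fun x : 'rV[R]_n => al * `|dot e (x - z)|)}.
    apply: for_continuousM; first exact: for_continuous_cst.
    exact: cvg_norm (@continuous_dot_shift R n e z z).
  have : al * `|dot e (z - z)| < 1.
    by rewrite /dot big1 ?normr0 ?mulr0 // => i _; rewrite subrr mxE mulr0.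
  move=> /(cvgr_lt _ C); apply: filterS => x; exact: ltW.
have Unear : nbhs z U by exact: open_nbhs_nbhs.
have [r' /= r'0 Hr'] :=
  (nbhs_ballP _ _).1 (filterI Unear (filterI touch (filterI Lvnear small))).
pose r := r' / 2; have r0 : 0 < r by rewrite divr_gt0.
have inD x : `|x - z| <= r ->
    [/\ U x, u x = m -> 2 * dot e (x - z) <= dot (x - z) (x - z),
        0 < Lv x & al * `|dot e (x - z)| <= 1].
  move=> xr; have xb : ball z r' x.
    by rewrite -ball_normE /= distrC (le_lt_trans xr) // /r; lra.
  by have [? [? []]] := Hr' x xb; split.
have vneg x : `|x - z| <= r -> x != z -> u x = m -> v x < 0.
  by move=> /inD[_ H _ s] xz /H; move/barrier_lt0; apply.
pose D := [set x : 'rV[R]_n | `|x - z| <= r].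
have cD : closed D by exact: closed_norm_le.
have kD : compact D by apply: (@compact_norm_le R n z r) => //.
have zD : D z by rewrite /D /= subrr normr0 ltW.
have vcont x : {for x, continuous v} by exact: continuous_barrier.
(* The part of the boundary of the cube [D] where adding a multiple of [v] does not decrease [u].
   Since [v < 0] at the points of [{u = m}] in [D] other than [z], there [u < m], by compactness
   with a uniform gap [del]. *)
pose S := D `&` v @^-1` [set t | 0 <= t] `&`
  (fun x : 'rV[R]_n => `|x - z|) @^-1` [set t | r <= t].
have [del del0 uS] : exists2 del, 0 < del & forall x, S x -> u x <= m - del.
  have kS : compact S.
    apply: (@compact_norm_le R n z r); last by move=> x [[]].
    apply: closed_setI_preimage; [|exact: closed_ge|].
      apply: closed_setI_preimage => //; exact: closed_ge.
    move=> x _; have cB : (fun y => y - z) @ nbhs x --> x - z.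
      by apply: cvgB; [exact: cvg_id|exact: cvg_cst].
    exact: cvg_norm cB.
  have [S0|/set0P S0] := eqVneq S set0.
    by exists 1 => // x; rewrite S0.
  have cu : {within S, continuous u}.
    apply: continuous_in_subspaceT => x /set_mem[[xD _] _]; apply: u_cont.
    by have [] := inD x xD.
  have [s /set_mem sS smax] := compact_EVT_max S0 kS cu.
  have [[sD /= sv] sr] := sS.
  exists (m - u s) => [|x xS]; last by rewrite opprB addrC subrK smax ?inE.
  have [Us _ _ _] := inD s sD.
  rewrite subr_gt0 lt_neqAle u_le // andbT; apply/eqP => us.
  have sz : s != z.
    by apply: contraTneq r0 => sz; rewrite -leNgt (le_trans sr) // sz subrr normr0.
  by have := vneg s sD sz us; rewrite ltNge sv.
have D0 : D !=set0 by exists z.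
have [V V0 vV] : exists2 V, 0 <= V & forall x, D x -> v x <= V.
  have cv : {within D, continuous v}.
    by apply: continuous_in_subspaceT => x _; exact: vcont.
  have [s /set_mem sD smax] := compact_EVT_max D0 kD cv.
  exists (v s) => [|x xD]; last by rewrite smax ?inE.
  by rewrite -(barrier_center e z al) smax ?inE.
(* The added 1 makes [eps * V < del] strict, and allows [V = 0]. *)
pose eps := del / (V + 1).
have V10 : 0 < V + 1 by rewrite ltr_wpDl.
have eps0 : 0 < eps by rewrite divr_gt0.
pose w x := u x + eps * v x.
have wcont x : U x -> {for x, continuous w}.
  move=> Ux; apply: for_continuousD; first exact: u_cont.
  by apply: for_continuousM; [exact: for_continuous_cst|exact: vcont].
have cw : {within D, continuous w}.
  apply: continuous_in_subspaceT => x /set_mem xD; apply: wcont.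
  by have [] := inD x xD.
have [p /set_mem pD pmax] := compact_EVT_max D0 kD cw.
have wp : m <= w p.
  have <- : w z = m by rewrite /w uz /v barrier_center mulr0 addr0.
  by rewrite pmax ?inE.
have [Up _ Lvp _] := inD p pD.
(* [w z = m], whereas [w < m] on the boundary of the cube: by the gap [del] where [v >= 0], by the
   sign of [v] elsewhere. *)
have pint : `|p - z| < r.
  rewrite ltNge; apply/negP => pr; have [vp|vp] := leP 0 (v p).
    have up : u p <= m - del by apply: uS.
    have : eps * v p < del.
      rewrite /eps mulrAC ltr_pdivrMr // ltr_pM2l //.
      by rewrite (le_lt_trans (vV p pD)) // ltrDl.
    by move: wp; rewrite /w; lra.
  have : eps * v p < 0 by rewrite pmulr_rlt0.
  by move: wp (u_le Up); rewrite /w; lra.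
have wmax : \forall x \near p, w x <= w p.
  apply/nbhs_ballP; exists (r - `|p - z|); first by rewrite /= subr_gt0.
  move=> x; rewrite -ball_normE /= distrC => xp; rewrite pmax ?inE //.
  rewrite /D /= (_ : x - z = (x - p) + (p - z)); last by rewrite addrA subrK.
  by rewrite (le_trans (ler_normD _ _)) // -lerBrDr ltW.
(* The operator applied to [w] is at least [eps * Lv p > 0] at [p], which contradicts the interior
   maximum. *)
suff : elliptic_op (fun j y => d1 j y + eps * barrier1 e z al j y)
    (fun i j y => d2 i j y + eps * barrier2 e al i j y) p <= 0.
  rewrite elliptic_opD leNgt -/(Lv p).
  by rewrite ltr_wpDl // ?u_subsolution // mulr_gt0.
apply: (@elliptic_op_le0_at_max w) => //.
- move=> x Ux j; apply: is_derive_funD; first exact: u_derive.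
  exact/is_derive_funZ/is_derive_barrier.
- move=> x Ux i j; apply: is_derive_funD; first exact: d1_derive.
  exact/is_derive_funZ/is_derive_barrier1.
- move=> x Ux j; apply: for_continuousD; first exact: d1_cont.
  by apply: for_continuousM; [exact: for_continuous_cst|exact: continuous_barrier1].
- move=> i j; apply: for_continuousD; first exact: d2_cont.
  exact: for_continuous_cst.
Qed.

(** If [u y] differs from [m] for some [y] close to [x0], the Euclidean ball about [y] that reaches
    a nearest point [z] of [{u = m}] is touched at [z] from outside, against [hopf_no_touching]. *)
Lemma strong_maximum_principle x0 : U x0 -> u x0 = m -> \forall x \near x0, u x = m.
Proof.
move=> Ux0 ux0.
have Unear : nbhs x0 U by exact: open_nbhs_nbhs.
have [r' /= r'0 Hr'] := (nbhs_ballP _ _).1 Unear.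
pose r := r' / 2; have r0 : 0 < r by rewrite divr_gt0.
have inU x : `|x - x0| <= r -> U x.
  by move=> xr; apply: Hr'; rewrite -ball_normE /= distrC (le_lt_trans xr) // /r; lra.
have N0 : 0 < n%:R + 2 :> R by rewrite ltr_wpDl.
(* A factor [n + 1] covers the passage between Euclidean and max norms, and one more [|x0 - y|]
   comes from the triangle inequality; thus [z] lies in the interior of the cube. *)
apply/nbhs_ballP; exists (r / (n%:R + 2)); first by rewrite /= divr_gt0.
move=> y; rewrite -ball_normE /= ltr_pdivlMr // => yr.
apply: contrapT => uy.
pose K := [set x : 'rV[R]_n | `|x - x0| <= r] `&` u @^-1` [set m].
have kK : compact K.
  apply: (@compact_norm_le R n x0 r); last by move=> x [].
  apply: closed_setI_preimage; [exact: closed_norm_le|exact: closed_eq|].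
  by move=> x /inU; exact: u_cont.
have K0 : K !=set0 by exists x0; split=> //=; rewrite subrr normr0 ltW.
pose q x := dot (x - y) (x - y).
have cq : {within K, continuous q}.
  apply: continuous_in_subspaceT => x _; apply: for_continuous_sum => j _.
  by apply: for_continuousM; exact: continuous_shifted_coord.
have [z /set_mem zK zmin] := compact_EVT_min K0 kK cq.
have [zr uz] := zK.
(* The Euclidean norm lies between the max norm and [sqrt n] times it; [n <= (n + 1)^2] avoids the
   square root. *)
have zy : `|z - y| <= (n%:R + 1) * `|x0 - y|.
  apply/rV_norm_le => [|i]; first by rewrite mulr_ge0 // addr_ge0.
  rewrite -ler_sqr ?nnegrE ?mulr_ge0 ?addr_ge0 // real_normK ?num_real //.
  have qz : (z - y) 0 i ^+ 2 <= q z.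
    rewrite /q /dot (bigD1 i) //= -expr2 lerDl.
    by apply: sumr_ge0 => j _; rewrite -expr2 sqr_ge0.
  have qx0 : q x0 <= n%:R * `|x0 - y| ^+ 2.
    rewrite mulr_natl -[X in _ *+ X]card_ord -sumr_const; apply: ler_sum => j _.
    rewrite -expr2 -real_normK ?num_real // ler_sqr ?nnegrE //; exact: rV_coord_le.
  apply: (le_trans qz); apply: (le_trans (zmin x0 _)).
    by rewrite inE; split=> //=; rewrite subrr normr0 ltW.
  apply: (le_trans qx0); rewrite exprMn ler_wpM2r ?sqr_ge0 //.
  by have := ler0n R n; nra.
have zint : `|z - x0| < r.
  apply: le_lt_trans yr; rewrite (_ : z - x0 = (z - y) - (x0 - y)); last first.
    by rewrite opprB addrA subrK.
  by rewrite (le_trans (ler_normB _ _)) //; lra.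
apply: (@hopf_no_touching z (y - z)) => //; first exact: (inU z zr).
  by rewrite subr_eq0; apply: contra_notN uy => /eqP ->.
apply/nbhs_ballP; exists (r - `|z - x0|); first by rewrite /= subr_gt0.
move=> x; rewrite -ball_normE /= distrC => xz ux.
have xK : K x.
  split=> //=; rewrite (_ : x - x0 = (x - z) + (z - x0)); last by rewrite addrA subrK.
  by rewrite (le_trans (ler_normD _ _)) // -lerBrDr ltW.
(* Expanding [|x - y|^2 >= |z - y|^2] (Euclidean) around [z] gives the touching condition for
   [e = y - z]. *)
have := zmin x; rewrite inE => /(_ xK); rewrite /q -subr_ge0 /dot -sumrB => H.
rewrite -subr_ge0 mulr_sumr -sumrB; apply: le_trans H _.
by apply: ler_sum => i _; rewrite !mxE; nra.
Qed.

End strong_maximum_principle.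

(** * The metric trace *)

Section trace.
Variables (R : realType) (n : nat) (M : ptopologicalType).
Variables (X : smooth_structure R n M) (g : riem_metric X).
Variables (c : chart R n M) (x : 'rV[R]_n).
Hypotheses (cX : atlas X c) (cx : cimg c x).

Lemma metric_posdef : posdefmx (g c x).
Proof. by split; [exact: gmx_sym|exact: gmx_pos]. Qed.

Lemma trace_gD A B : trace_g g c x (A + B) = trace_g g c x A + trace_g g c x B.
Proof.
rewrite /trace_g -big_split; apply: eq_bigr => i _; rewrite -big_split.
by apply: eq_bigr => j _; rewrite mxE mulrDr.
Qed.

Lemma trace_gZ k A : trace_g g c x (k *: A) = k * trace_g g c x A.
Proof.
rewrite /trace_g mulr_sumr; apply: eq_bigr => i _; rewrite mulr_sumr.
by apply: eq_bigr => j _; rewrite mxE mulrCA.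
Qed.

Lemma trace_gN A : trace_g g c x (- A) = - trace_g g c x A.
Proof. by rewrite -scaleN1r trace_gZ mulN1r. Qed.

Lemma trace_g_tr A : trace_g g c x A^T = trace_g g c x A.
Proof.
rewrite /trace_g exchange_big; apply: eq_bigr => i _; apply: eq_bigr => j _ /=.
rewrite mxE; congr (_ * _).
by have [sg _] := metric_posdef; rewrite -{1}(invmx_sym sg) mxE.
Qed.

Lemma trace_g_metric : trace_g g c x (g c x) = n%:R.
Proof.
have [sg _] := metric_posdef.
transitivity (\tr (invmx (g c x) *m (g c x)^T)).
  rewrite /mxtrace; apply: eq_bigr => i _; rewrite mxE; apply: eq_bigr => j _.
  by rewrite mxE.
by rewrite sg mulVmx ?mxtrace1 // posdefmx_unit //; exact: metric_posdef.
Qed.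

End trace.

(** * The critical equation, the Laplacian in charts and subharmonic functions *)

Section critical_metrics.
Variables (R : realType) (n : nat) (M : ptopologicalType).
Variables (X : smooth_structure R n M) (g : riem_metric X).

(** [nabla] differentiates the components, so agreement at [x] alone is not enough; the chart image
    is an open neighbourhood of [x]. *)
Lemma nabla_congr (theta eta : chart R n M -> 'rV[R]_n -> 'rV[R]_n) c x :
  cimg c x -> (forall y, cimg c y -> theta c y = eta c y) ->
  nabla g theta c x = nabla g eta c x.
Proof.
move=> cx E; apply/matrixP => i j; rewrite !mxE; congr (_ - _); last first.
  by apply: eq_bigr => k _; rewrite E.
apply: near_eq_derive; have : nbhs x (cimg c).
  by apply: open_nbhs_nbhs; split=> //; exact: cimg_open.
by apply: filterS => y /E ->.
Qed.

(** The trace of the Einstein tensor is [- (n - 2) / 2] times [s], that of [Bstar] is the same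
    multiple of [Delta f], and the last term contributes [- (n - 2) / 2] times [sbar]; dimension at
    least 3 permits cancelling the factor. *)
Lemma chen_nagano_laplacian theta f c x : (2 < n)%N -> chen_nagano g theta ->
  in_charts X (fun c x => theta c x = differential f c x) ->
  atlas X c -> cimg c x ->
  laplacian g f c x = scal g c x - scal_average g.
Proof.
move=> n3 crit exact_ cX cx; have := crit c cX x cx.
rewrite /Bstar /delta_star /codiff /einstein_tensor.
rewrite (@nabla_congr theta (differential f)) //; last by move=> y; exact: exact_.
rewrite -/(hess g f c x) -/(laplacian g f c x) => /(congr1 (trace_g g c x)).
rewrite !(trace_gD, trace_gN, trace_gZ) trace_g_tr // trace_g_metric //.
rewrite -/(scal g c x) -/(laplacian g f c x).
set s := scal _ _ _; set L := laplacian _ _ _ _; set sb := scal_average _ => H.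
have n0 : n%:R - 2 != 0 :> R by rewrite subr_eq0 eqr_nat gtn_eqF.
have n00 : n%:R != 0 :> R by rewrite pnatr_eq0 -lt0n (ltn_trans _ n3).
apply: (mulfI n0).
have : (n%:R - 2) / (2 * n%:R) * sb * n%:R = (n%:R - 2) * sb / 2 by field.
by move: H; lra.
Qed.

Lemma continuous_metric_inverse c x i j : atlas X c -> cimg c x ->
  {for x, continuous (fun y => invmx (g c y) i j)}.
Proof.
move=> cX cx; apply: for_continuous_invmx => [k l|].
  by have [H _] := @gmx_smooth R n M X g c cX k l 0; exact: H.
by apply: posdefmx_unit; exact: metric_posdef.
Qed.

Lemma continuous_christoffel c x k i j : atlas X c -> cimg c x ->
  {for x, continuous (christoffel g c k i j)}.
Proof.
move=> cX cx.
have cp i' j' l' : {for x, continuous (partial i' (fun y => g c y j' l'))}.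
  by have [_ /(_ i')[_ [H _]]] := @gmx_smooth R n M X g c cX j' l' 1; exact: H.
apply: for_continuousM; first exact: for_continuous_cst.
apply: for_continuous_sum => l _; apply: for_continuousM.
  exact: continuous_metric_inverse.
apply: for_continuousD; first exact: for_continuousD.
exact/for_continuousN/cp.
Qed.

(** This is the Laplacian of the [k]-th coordinate function. *)
Definition laplacian_drift c k x : R :=
  - \sum_i \sum_j invmx (g c x) i j * christoffel g c k i j x.

Lemma laplacianE f c x : laplacian g f c x =
  elliptic_op (fun y => invmx (g c y)) (laplacian_drift c)
    (fun j => partial j (f \o cinv c)) (fun i j => partial i (partial j (f \o cinv c))) x.
Proof.
have Ed j : (fun y => differential f c y 0 j) = partial j (f \o cinv c).
  by apply/funext => y; rewrite mxE.
rewrite /laplacian /hess /trace_g /elliptic_op.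
transitivity (\sum_i \sum_j (invmx (g c x) i j * partial i (partial j (f \o cinv c)) x
   + \sum_k - (invmx (g c x) i j * christoffel g c k i j x * partial k (f \o cinv c) x))).
  apply: eq_bigr => i _; apply: eq_bigr => j _.
  rewrite !mxE Ed mulrBr sumrN mulr_sumr; congr (_ - _).
  by apply: eq_bigr => k _; rewrite mxE mulrA.
under eq_bigr do rewrite big_split /=.
rewrite big_split /=; congr (_ + _).
under eq_bigr do rewrite exchange_big /=.
rewrite exchange_big /=; apply: eq_bigr => k _.
rewrite /laplacian_drift mulNr mulr_suml -sumrN; apply: eq_bigr => i _.
by rewrite mulr_suml -sumrN.
Qed.

Section subharmonic.
Variables (f : M -> R) (s : R).
Hypothesis f_smooth : smooth_function X f.
Hypothesis f_subharmonic : in_charts X (fun c x => 0 <= s * laplacian g f c x).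

(** The factor [s], later 1 or -1, lets one argument serve both signs of the Laplacian. *)
Lemma subharmonic_local_max c x m : atlas X c -> cimg c x ->
  (forall p, s * f p <= m) -> s * f (cinv c x) = m ->
  \forall y \near x, s * f (cinv c y) = m.
Proof.
move=> cX cx fm fx; pose u := f \o cinv c.
have [u0 u12] := f_smooth cX 2.
apply: (@strong_maximum_principle R n (cimg c) (fun y => invmx (g c y))
  (laplacian_drift c) (fun y => s * u y) (fun j y => s * partial j u y)
  (fun i j y => s * partial i (partial j u) y)) => //.
- exact: cimg_open.
- by move=> y cy; apply: posdefmx_inv; exact: metric_posdef.
- by move=> y cy i j; exact: continuous_metric_inverse.
- move=> y cy k; apply: for_continuousN; apply: for_continuous_sum => i _.
  apply: for_continuous_sum => j _; apply: for_continuousM.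
    exact: continuous_metric_inverse.
  exact: continuous_christoffel.
- by move=> y cy; apply: for_continuousM; [exact: for_continuous_cst|exact: u0].
- move=> y cy j; apply: for_continuousM; first exact: for_continuous_cst.
  by have [_ [H _]] := u12 j; exact: H.
- move=> y cy i j; apply: for_continuousM; first exact: for_continuous_cst.
  by have [_ [_ /(_ i)[_ [H _]]]] := u12 j; exact: H.
- move=> y cy j; apply: is_derive_funZ; apply: derivableP.
  by have [H _] := u12 j; exact: H.
- move=> y cy i j; apply: is_derive_funZ; apply: derivableP.
  by have [_ [_ /(_ i)[H _]]] := u12 j; exact: H.
- move=> y cy; have := f_subharmonic cX cy; rewrite laplacianE; congr (0 <= _).
  rewrite /elliptic_op mulrDr !mulr_sumr; congr (_ + _).
    apply: eq_bigr => i _; rewrite mulr_sumr; apply: eq_bigr => j _.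
    by rewrite mulrCA.
  by apply: eq_bigr => k _; rewrite mulrCA.
- by move=> y _; exact: fm.
Qed.

Lemma smooth_function_continuous : continuous f.
Proof.
move=> p; have cX := chart_at_atlas X p; have cp := chart_at_cdom X p.
set c := chart_at X p in cX cp.
have [u0 _] := f_smooth cX 0.
have H : {for p, continuous ((f \o cinv c) \o cmap c)}.
  by apply: continuous_comp; [exact: cmap_continuous|exact/u0/cmap_cimg].
have cdomp : nbhs p (cdom c) by apply: open_nbhs_nbhs; split=> //; exact: cdom_open.
move: H; rewrite /prop_for /continuous_at /= cmapK // => H; apply: cvg_trans H.
by apply: near_eq_cvg; apply: filterS cdomp => q cq /=; rewrite cmapK.
Qed.

Lemma subharmonic_constant : compact [set: M] -> connected [set: M] ->
  exists m, forall p, s * f p = m.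
Proof.
move=> kM connM.
have cF (p : M) : {for p, continuous (fun q => s * f q)}.
  apply: for_continuousM; first exact: for_continuous_cst.
  exact: smooth_function_continuous.
have M0 : [set: M] !=set0 by exists point.
have cFT : {within [set: M], continuous (fun q => s * f q)}.
  by apply: continuous_in_subspaceT => p _; exact: cF.
have [p0 _ p0max] := compact_EVT_max M0 kM cFT.
exists (s * f p0).
have Fle p : s * f p <= s * f p0 by rewrite p0max ?inE.
pose A := [set p : M | s * f p = s * f p0].
suff AT : A = [set: M] by move=> p; have : A p by rewrite AT.
apply: connM; first by exists p0.
- exists A; last by rewrite setTI.
  rewrite openE => p Ap; have cX := chart_at_atlas X p; have cp := chart_at_cdom X p.
  set c := chart_at X p in cX cp.
  have cdomp : nbhs p (cdom c) by apply: open_nbhs_nbhs; split=> //; exact: cdom_open.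
  have xA : s * f (cinv c (cmap c p)) = s * f p0 by rewrite cmapK.
  have := subharmonic_local_max cX (cmap_cimg cp) Fle xA.
  (* The neighbourhood found in the chart is pulled back to [M] and cut with [cdom c], where
     [cinv c] undoes [cmap c]. *)
  move=> /(cmap_continuous cp) N; rewrite /interior.
  apply: (@filterS _ (nbhs p) _ _ _ _ (filterI cdomp N)) => q [cq].
  by rewrite /A /= cmapK.
- exists A; last by rewrite setTI.
  have -> : A = setT `&` (fun q => s * f q) @^-1` [set s * f p0] by rewrite setTI.
  apply: closed_setI_preimage => [||p _]; [exact: closedT|exact: closed_eq|exact: cF].
Qed.

End subharmonic.

Lemma constant_laplacian_constant f (k : R) :
  compact [set: M] -> connected [set: M] -> smooth_function X f ->
  in_charts X (fun c x => laplacian g f c x = k) -> constant_function f.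
Proof.
move=> kM connM fs lapk; have [k0|k0] := leP 0 k.
  have [|m Hm] := @subharmonic_constant f 1 fs _ kM connM.
    by move=> c cX x cx; rewrite lapk // mul1r.
  by exists m => p; rewrite -(Hm p) mul1r.
have [|m Hm] := @subharmonic_constant f (- 1) fs _ kM connM.
  by move=> c cX x cx; rewrite lapk // mulN1r oppr_ge0 ltW.
by exists (- m) => p; rewrite -(Hm p) mulN1r opprK.
Qed.

Lemma hess_constant f c x : constant_function f -> hess g f c x = 0.
Proof.
move=> [k fk].
have d0 y : differential f c y = 0.
  apply/rowP => j; rewrite !mxE /partial.
  have -> : f \o cinv c = cst k by apply/funext => z /=; rewrite fk.
  exact: derive_cst.
apply/matrixP => i j; rewrite !mxE.
have -> : (fun y => differential f c y 0 j) = cst 0.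
  by apply/funext => y; rewrite d0 mxE.
rewrite /partial derive_cst sub0r big1 ?oppr0 // => k' _.
by rewrite d0 mxE mulr0.
Qed.

End critical_metrics.

Theorem theorem5p1 (R : realType) (n : nat) (M : ptopologicalType)
    (X : smooth_structure R n M) (g : riem_metric X)
    (n_ge3 : (3 <= n)%N)
    (M_compact : compact [set: M]) (M_connected : connected [set: M])
    (theta : one_form X) (g_critical : chen_nagano g theta)
    (f : M -> R) (f_smooth : smooth_function X f)
    (theta_exact : in_charts X (fun c x => theta c x = differential f c x))
    (s_constant : constant_scal g) :
  [/\ einstein_metric g,
      constant_function f,
      ricci_almost_soliton g f (soliton_lambda g f) &
      trivial_soliton g f (soliton_lambda g f)].
Proof.
have [k scalk] := s_constant.
have lapk : in_charts X (fun c x => laplacian g f c x = k - scal_average g).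
  move=> c cX x cx.
  by rewrite (chen_nagano_laplacian n_ge3 g_critical theta_exact cX cx) scalk.
have fconst := constant_laplacian_constant M_compact M_connected f_smooth lapk.
have hess0 c x : hess g f c x = 0 by exact: hess_constant.
have lap0 c x : laplacian g f c x = 0.
  rewrite /laplacian hess0 /trace_g big1 // => i _.
  by rewrite big1 // => j _; rewrite mxE mulr0.
(* What is left of [soliton_lambda] once the Laplacian vanishes and the scalar curvature is [k]. *)
pose l : R := - ((n%:R - 2) / (2 * n%:R) * scal_average g) + 2^-1 * k.
have lambdal : in_charts X (fun c x => soliton_lambda g f c x = l).
  by move=> c cX x cx; rewrite /soliton_lambda lap0 scalk // mulr0 subr0.
have riccil : in_charts X (fun c x => ricci g c x = l *: g c x).
  move=> c cX x cx; have := g_critical c cX x cx.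
  rewrite /Bstar /delta_star /codiff /einstein_tensor.
  rewrite (@nabla_congr _ _ _ _ g theta (differential f)) //; last first.
    by move=> y; exact: theta_exact.
  rewrite -/(hess g f c x) -/(laplacian g f c x) lap0 hess0 scalk //.
  (* With zero Hessian [Bstar] vanishes, and the critical equation makes the Einstein tensor a
     constant multiple of [g]; moving the scalar curvature term across gives [l]. *)
  rewrite trmx0 addr0 scaler0 oppr0 mulr0 scale0r !add0r => /eqP.
  by rewrite subr_eq -scaleNr -scalerDl => /eqP.
split=> //.
- by exists l.
- by move=> c cX x cx; rewrite hess0 subr0 lambdal // riccil.
- split=> //; exists l => c cX x cx; split; [exact: hess0|exact: lambdal|exact: riccil].
Qed.
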